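(* There is an absolute constant $C>0$ such that for every odd prime power $q$ and every stable quadratic polynomial $f\in\mathbb{F}_q[X]$ we have $t_f \leqslant C q^{3/4}$; that is, $t_f = O\left(q^{3/4}\right)$.
   Context: Let $\mathbb{F}_q$ be the finite field with $q$ elements, $q$ odd. For $f\in\mathbb{F}_q[X]$ define iterates $f^{(0)}(X)=X$ and $f^{(n)}(X)=f\left(f^{(n-1)}(X)\right)$ for $n\geqslant 1$. The polynomial $f$ is called stable if $f^{(n)}$ is irreducible over $\mathbb{F}_q$ for every $n\geqslant 1$. For a quadratic polynomial $f(X)=aX^2+bX+c\in\mathbb{F}_q[X]$ with $a\neq 0$, let $\gamma=-b/(2a)$ be its critical point. Define $t_f$ to be the smallest positive integer $t$ such that $f^{(t)}(\gamma)=f^{(s)}(\gamma)$ for some positive integer $s<t$. (The critical orbit $\{f^{(n)}(\gamma): n\geqslant 2\}$ then equals $\{f^{(n)}(\gamma): 2\leqslant n\leqslant t_f\}$.) *)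

(* Defs.v *)
From HB Require Import structures.
From mathcomp Require Import all_boot all_order all_algebra all_field.
Set Implicit Arguments.
Unset Strict Implicit.
Unset Printing Implicit Defensive.
Import GRing.Theory.
Local Open Scope ring_scope.

Definition poly_iterate (F : fieldType) (f : {poly F}) (n : nat) : {poly F} :=
  iter n (fun g : {poly F} => f \Po g) 'X.

Definition stable_poly (F : fieldType) (f : {poly F}) : Prop :=
  forall n : nat, (1 <= n)%N -> irreducible_poly (poly_iterate f n).

(* Meaningful when f = a X^2 + b X + c with 2 a != 0: the value is -b/(2a). *)
Definition critical_point (F : fieldType) (f : {poly F}) : F :=
  - f`_1 / (2%:R * f`_2).

Definition critical_collision (F : finFieldType) (f : {poly F}) (t : nat) :
    bool :=
  [exists s : 'I_t, (0 < s)%N &&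
    ((poly_iterate f t).[critical_point f]
       == (poly_iterate f s).[critical_point f])].

Lemma critical_collision_ex (F : finFieldType) (f : {poly F}) :
  exists t : nat, (0 < t)%N && critical_collision f t.
Proof.
pose h (i : 'I_#|F|.+1) := (poly_iterate f i.+1).[critical_point f].
have /injectivePn[i [j neq_ij eq_h]] : ~~ injectiveb h.
  apply/negP => /injectiveP /leq_card.
  by rewrite card_ord ltnn.
wlog lt_ij : i j neq_ij eq_h / (i < j)%N => [hwlog|].
  case: (ltngtP i j) => [|lt_ji|/val_inj eq_ij]; first exact: hwlog.
    by apply: (hwlog j i) => //; rewrite eq_sym.
  by rewrite eq_ij eqxx in neq_ij.
exists j.+1; apply/andP; split=> //.
apply/existsP; exists (Ordinal (lt_ij : (i.+1 < j.+1)%N)).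
by apply/andP; split=> //=; apply/eqP; rewrite -[LHS]/(h j) -[RHS]/(h i).
Qed.

Definition t_crit (F : finFieldType) (f : {poly F}) : nat :=
  ex_minn (critical_collision_ex f).

(* Main.v *)
(* The critical orbit of a stable quadratic [f] consists of points [x] such that
   [a * f^(k)(x)] is a nonsquare for every [k >= 1] (Jones and Boston: if
   [a * f^(n)(gamma)] were a square for some [n >= 2], a norm computation in the
   field generated by a root of [f^(n-1)] would give a root of [f^(n)] there,
   contradicting its degree).  Fix [K] with [2^K] of order [q^(1/4)].  The number
   of [x] in [F] passing this test for [k = 1, ..., K] is [2^-K] times a sum over
   the subsets [S] of [{1, ..., K}] of quadratic character sums of the
   polynomials [\prod_(k in S) a * f^(k)], which are not squares since the
   iterates are irreducible of distinct degrees.  The empty set contributes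
   [q / 2^K], and Weil's bound [O(d * sqrt q)] for polynomials of degree
   [d <= 2^(K+1)] makes the others contribute [O(2^K * sqrt q)].

   Weil's bound for [y^2 = h(x)] is obtained by Stepanov's method: a nonzero
   polynomial [P = \sum_j (h^M r_j + h^(M+c) s_j) X^(jq)], with [c = (q-1)/2],
   is chosen by counting coefficients so that it vanishes to order [M] wherever
   [h^c] takes a prescribed value, and the degree of [P] bounds the number of
   these points. *)

Require Import Defs.
From HB Require Import structures.
From mathcomp Require Import all_boot all_order all_algebra.
From mathcomp Require Import all_fingroup all_solvable all_field.
From mathcomp Require Import reals exp zify ring.
Import Order.TTheory GRing.Theory Num.Theory.
Set Implicit Arguments.
Unset Strict Implicit.
Unset Printing Implicit Defensive.
Local Open Scope ring_scope.

(** * Stepanov's method *)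

Section Irreducible.

Variable F : fieldType.
Implicit Types p r s G : {poly F}.

Lemma irredp_dvdM p r s :
  irreducible_poly p -> p %| r * s -> (p %| r) || (p %| s).
Proof.
move=> irr_p; case: (boolP (p %| r)) => //= Npr.
by rewrite Gauss_dvdpr // irreducible_poly_coprime.
Qed.

Lemma irredp_dvdX p r n : irreducible_poly p -> p %| r ^+ n -> p %| r.
Proof.
move=> irr_p; elim: n => [|n IHn]; last first.
  by rewrite exprS => /(irredp_dvdM irr_p)/orP[].
rewrite expr0 dvdp1 => /eqP p1.
by case: irr_p; rewrite p1.
Qed.

Lemma irredp_dvd_prod (I : finType) (P : pred I) (f : I -> {poly F}) p :
  irreducible_poly p -> p %| \prod_(i | P i) f i -> exists2 i, P i & p %| f i.
Proof.
move=> irr_p; elim/big_rec: _ => [|i r Pi IH].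
  by rewrite dvdp1 => /eqP p1; case: irr_p; rewrite p1.
by case/(irredp_dvdM irr_p)/orP => [|/IH //]; exists i.
Qed.

(** Descent on the size of [r]: [p] divides [s], then [r] because [p] does not divide [G], and both
    can be divided by [p]. *)
Lemma irredp_odd_part_not_square p G (a : F) r s :
    irreducible_poly p -> ~~ (p %| G) -> a != 0 ->
  r ^+ 2 * (p * G) = a *: s ^+ 2 -> r = 0 /\ s = 0.
Proof.
move=> irr_p NpG a0.
have p0 : p != 0 by rewrite -size_poly_gt0; case: irr_p => /ltnW.
have G0 : G != 0 by apply: contraNneq NpG => ->; rewrite dvdp0.
suff r0 : r ^+ 2 * (p * G) = a *: s ^+ 2 -> r = 0.
  move=> E; have r_eq0 := r0 E; split=> //.
  move/esym/eqP: E; rewrite r_eq0 expr0n mul0r scaler_eq0 (negPf a0) /=.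
  by rewrite expf_eq0 => /eqP.
have [n] := ubnP (size r); elim: n r s => // n IHn r s lt_rn E.
apply/eqP/negPn/negP => r0.
have p_s : p %| s.
  apply: (@irredp_dvdX _ _ 2) => //.
  by rewrite -(dvdpZr _ _ a0) -E dvdp_mull // dvdp_mulr.
have [s' sE] := dvdpP _ _ p_s.
have E1 : r ^+ 2 * G = p * (a *: s' ^+ 2).
  by apply: (mulfI p0); rewrite mulrCA E sE exprMn -!mul_polyC; ring.
have p_r : p %| r.
  apply: (@irredp_dvdX _ _ 2) => //.
  have : p %| r ^+ 2 * G by rewrite E1 dvdp_mulr.
  by case/(irredp_dvdM irr_p)/orP => //; rewrite (negPf NpG).
have [r' rE] := dvdpP _ _ p_r.
have r'0 : r' != 0 by apply: contraNneq r0 => r'0; rewrite rE r'0 mul0r.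
suff: r' = 0 by move/eqP; rewrite (negPf r'0).
apply: (IHn r' s').
  move: lt_rn; rewrite rE size_mul //; have [+ _] := irr_p.
  by move: (size r') (size p) => u v; lia.
by apply: (mulfI p0); rewrite -E1 rE; ring.
Qed.

End Irreducible.

(** * Hasse derivatives and multiplicity *)

Section Taylor.

Variable F : fieldType.
Implicit Types p r s : {poly F}.

Lemma poly_XaYD p r : poly_XaY (p + r) = poly_XaY p + poly_XaY r.
Proof. by rewrite /poly_XaY rmorphD linearD. Qed.

Lemma poly_XaYM p r : poly_XaY (p * r) = poly_XaY p * poly_XaY r.
Proof. by rewrite /poly_XaY rmorphM comp_polyM. Qed.

Lemma poly_XaYXn p n : poly_XaY (p ^+ n) = poly_XaY p ^+ n.
Proof.
elim: n => [|n IHn]; last by rewrite !exprS poly_XaYM IHn.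
by rewrite !expr0 /poly_XaY rmorph1 comp_polyC.
Qed.

Lemma poly_XaY_sum (I : Type) (t : seq I) (P : pred I) (f : I -> {poly F}) :
  poly_XaY (\sum_(i <- t | P i) f i) = \sum_(i <- t | P i) poly_XaY (f i).
Proof. by rewrite (big_morph _ poly_XaYD (poly_XaY0 F)). Qed.

Lemma poly_XaYZ (a : F) p : poly_XaY (a *: p) = a%:P *: poly_XaY p.
Proof.
by rewrite -mul_polyC poly_XaYM {1}/poly_XaY map_polyC comp_polyC mul_polyC.
Qed.

Lemma poly_XaYX : poly_XaY ('X : {poly F}) = 'X + 'Y.
Proof. by rewrite /poly_XaY map_polyX comp_polyX. Qed.

Lemma size_coef_poly_XaY p (l : nat) : (size ((poly_XaY p)`_l)%R <= size p)%N.
Proof.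
rewrite -[in poly_XaY p](coefK p) poly_def poly_XaY_sum coef_sum.
apply: (leq_trans (size_sum _ _ _)); apply/bigmax_leqP => i _.
rewrite poly_XaYZ coefZ mul_polyC (leq_trans (size_scale_leq _ _)) //.
rewrite poly_XaYXn poly_XaYX addrC exprDn coef_sum.
apply: (leq_trans (size_sum _ _ _)); apply/bigmax_leqP => j _.
rewrite coefMn -rmorphXn coefCM coefXn.
rewrite -mulrnAr -mulrnA -polyC1 -polyCMn mulrC mul_polyC.
apply: (leq_trans (size_scale_leq _ _)); rewrite size_polyXn.
by apply: leq_ltn_trans (ltn_ord i); rewrite leq_subr.
Qed.

Lemma poly_XaY_coef0 p : (poly_XaY p)`_0 = p.
Proof. by rewrite -horner_coef0 horner_poly_XaY add0r comp_polyXr. Qed.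

(** Hasse derivatives detect multiplicity in every characteristic: putting [x] for the inner
    variable gives p(X + x), whose first [M] coefficients vanish. *)
Lemma XsubC_exp_dvdp_Taylor (x : F) p M :
  (forall l, (l < M)%N -> ((poly_XaY p)`_l).[x] = 0) -> ('X - x%:P) ^+ M %| p.
Proof.
move=> px0.
have E : map_poly (horner_eval x) (poly_XaY p) = p \Po ('X + x%:P).
  rewrite /poly_XaY map_comp_poly rmorphD /= map_polyX map_polyC /= horner_evalE hornerX.
  congr (_ \Po _); rewrite -map_poly_comp.
  by apply: map_poly_id => y _ /=; rewrite horner_evalE hornerC.
have : 'X^M %| p \Po ('X + x%:P).
  rewrite -E; set w := map_poly _ _.
  have -> : w = drop_poly M w * 'X^M.
    apply/polyP => i; rewrite coefMXn coef_drop_poly.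
    case: ltnP => [lt_iM|le_Mi]; last by rewrite subnK.
    by rewrite coef_map /= horner_evalE px0.
  exact: dvdp_mulIr.
move/(dvdp_comp_poly ('X - x%:P)).
rewrite comp_Xn_poly -comp_polyA comp_polyD comp_polyX comp_polyC.
by rewrite subrK comp_polyXr.
Qed.

(** Leibniz rule: a Hasse derivative of order [l] destroys at most [l] factors [p], since each
    factor p(X + Y) contributes either [p] itself or a term of positive order. *)
Lemma exp_dvdp_coef_poly_XaY p r m l :
  p ^+ (m - l) %| (poly_XaY (p ^+ m * r))`_l.
Proof.
rewrite poly_XaYM poly_XaYXn; move: (poly_XaY r) => w.
elim: m l w => [|m IHm] l w; first by rewrite sub0n expr0 dvd1p.
rewrite exprS -mulrA coefM.
apply: (big_ind (fun u : {poly F} => p ^+ (m.+1 - l) %| u)) => [|u v|[[|i] /= lti] _].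
- exact: dvdp0.
- exact: dvdp_add.
- rewrite poly_XaY_coef0 subn0 (dvdp_trans (dvdp_exp2l p (_ : _ <= (m - l).+1)%N)) //.
    by lia.
  by rewrite exprS dvdp_mul // IHm.
- apply: dvdp_mull; apply: dvdp_trans (IHm _ _); apply: dvdp_exp2l.
  by lia.
Qed.

End Taylor.

(** Here M = 2m and J = m + 2(d + 1). Both sides contain 2mB; the surplus 4(d + 1)B is at least (d +
    1)(Q + 4m), which exceeds M^2 d + MJ since M^2 <= Q. *)
Lemma stepanov_unknowns_gt_equations m d B Q : (0 < m)%N -> (m.*2 ^ 2 <= Q)%N ->
  ((d.+1 + m.*2).*2 <= Q)%N -> (Q <= B.*2 + d.+1)%N ->
  (m.*2 * (B + m.*2 * d + (m + d.+1.*2)) < ((m + d.+1.*2) * B).*2)%N.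
Proof.
move=> m_gt0 leM led leB.
have h1 : (m.*2 ^ 2 * d.+1 <= Q * d.+1)%N by rewrite leq_mul2r leM orbT.
have h2 : ((d.+1 + m.*2).*2 * d.+1 <= Q * d.+1)%N by rewrite leq_mul2r led orbT.
have h3 : (Q * d.+1 <= (B.*2 + d.+1) * d.+1)%N by rewrite leq_mul2r leB orbT.
have h4 : (0 < m ^ 2)%N by rewrite expn_gt0 m_gt0.
by nia.
Qed.

(** With M = 2m, doubling the last hypothesis gives the main term MQ; the rest is at most 6(d + 1)Q
    + 2Md, hence at most 98(d + 1)M^2 as Q <= 16 M^2. *)
Lemma stepanov_degree_estimate m d B Q N :
  (Q <= 16 * m.*2 ^ 2)%N -> (B.*2 + d <= Q)%N -> (0 < m)%N ->
  (N * m.*2 <= (m.*2 + Q./2) * d + B + (m + d.+1.*2).-1 * Q)%N ->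
  (N.*2 <= Q + 98 * d.+1 * m.*2)%N.
Proof.
move=> le16 leB m_gt0 step.
rewrite -(leq_pmul2r (_ : 0 < m.*2)%N) ?double_gt0 //.
have h1 : (Q * d.+1 <= 16 * m.*2 ^ 2 * d.+1)%N by rewrite leq_mul2r le16 orbT.
have h2 : (Q./2.*2 * d <= Q * d)%N.
  by rewrite leq_mul2r -[leqRHS]odd_double_half leq_addl orbT.
have h3 : (0 < m ^ 2)%N by rewrite expn_gt0 m_gt0.
have h4 : (d <= d * m ^ 2)%N by rewrite leq_pmulr.
have h5 : (m * d <= d * m ^ 2)%N.
  by rewrite [leqRHS]mulnC leq_mul2r (leq_pmulr m m_gt0) orbT.
have h6 : ((m + d.+1.*2).-1 * Q <= (m + d.+1.*2) * Q)%N.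
  by rewrite leq_mul2r leq_pred orbT.
move: h1 h2 h3 h4 h5 h6 step leB; move: (Q./2) => c; rewrite -!muln2 -!mulnn => *.
by nia.
Qed.

(** * Frobenius and linear systems over a finite field *)

Section FiniteFieldPowers.

Variable F : finFieldType.

Lemma finField_pchar_nat_card : [pchar F].-nat #|F|.
Proof.
have [p pr_p charFp] := finPcharP F.
have := card_pprimeChar charFp; rewrite (_ : #|_| = #|F|) // => ->.
by rewrite pnatX pnatE // charFp.
Qed.

Lemma expr_cardD (R : comNzRingType) (x y : R) :
  [pchar R] =i [pchar F] -> (x + y) ^+ #|F| = x ^+ #|F| + y ^+ #|F|.
Proof.
move=> eq_char; apply: exprDn_pchar.
by rewrite (eq_pnat _ eq_char) finField_pchar_nat_card.
Qed.

Lemma poly_exp_card_modXn (p : {poly F}) :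
  'X^#|F| %| p ^+ #|F| - (p.[0])%:P.
Proof.
have [r pE] : exists r, p = r * 'X + (p.[0])%:P.
  have /factor_theorem[r E] : root (p - (p.[0])%:P) 0.
    by rewrite rootE !hornerE subrr.
  by exists r; rewrite -['X]subr0 -polyC0 -E subrK.
rewrite {1}pE expr_cardD; last exact: pchar_poly.
by rewrite exprMn -rmorphXn /= expf_card addrK dvdp_mulIr.
Qed.

(** Pigeonhole: the coefficient map has a target smaller than its source, and two vectors with equal
    images differ by a solution. *)
Lemma poly_system_nontrivial_solution (I : finType) M D
    (H : {ffun I -> F} -> nat -> {poly F}) :
    (forall u v l, H (u + v) l = H u l + H v l) ->
    (forall u l, (l < M)%N -> (size (H u l) <= D)%N) -> (M * D < #|I|)%N ->
  exists2 u : {ffun I -> F}, u != 0 & forall l, (l < M)%N -> H u l = 0.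
Proof.
move=> HD szH ltD.
pose Phi u := [ffun li : 'I_M * 'I_D => (H u li.1)`_li.2].
have /injectivePn[u [v neq_uv eq_uv]] : ~~ injectiveb Phi.
  apply/negP => /injectiveP /leq_card.
  rewrite !card_ffun card_prod !card_ord leqNgt => /negP; apply.
  by rewrite ltn_exp2l ?finNzRing_gt1.
exists (u - v); first by rewrite subr_eq0.
move=> l ltlM.
have -> : H (u - v) l = H u l - H v l.
  by apply/eqP; rewrite eq_sym subr_eq -HD subrK.
apply/eqP; rewrite subr_eq0; apply/eqP/polyP => i.
case: (ltnP i D) => [ltiD|leDi]; last first.
  by rewrite !nth_default // (leq_trans (szH _ _ ltlM) leDi).
have /ffunP/(_ (Ordinal ltlM, Ordinal ltiD)) := eq_uv.
by rewrite !ffunE.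
Qed.

End FiniteFieldPowers.

(** * The auxiliary polynomial *)

Section Stepanov.

Variables (F : finFieldType) (h p G : {poly F}).
Local Notation q := #|F|.
Local Notation c := (q./2).
Hypotheses (odd_q : odd q) (irr_p : irreducible_poly p) (NpG : ~~ (p %| G)).
Hypotheses (hE : h = p * G) (h00 : h.[0] != 0).

Let h0 : h != 0.
Proof. by apply: contraNneq h00 => ->; rewrite horner0. Qed.

Let qE : q = c.*2.+1.
Proof. by rewrite -[LHS]odd_double_half odd_q. Qed.

(** Modulo X^q only j = 0 survives. Multiplying by (r0 - s0 h^c) h and using h^q = h(0) modulo X^q
    gives r0^2 h = h(0) s0^2 modulo X^q, an equality because both degrees are below q. As [p]
    divides [h] exactly once, r0 = s0 = 0; then X^q cancels and induction applies. *)
Lemma stepanov_independence B J (r s : nat -> {poly F}) :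
    (B.*2 + (size h).-1 <= q)%N ->
    (forall j, size (r j) <= B)%N -> (forall j, size (s j) <= B)%N ->
    \sum_(j < J) (r j + s j * h ^+ c) * 'X^(j * q) = 0 ->
  forall j, (j < J)%N -> r j = 0 /\ s j = 0.
Proof.
move=> leBq; elim: J r s => [|J IHJ] r s szr szs //.
rewrite big_ord_recl mul0n expr0 mulr1.
rewrite (eq_bigr (fun j : 'I_J =>
  (r j.+1 + s j.+1 * h ^+ c) * 'X^(j * q) * 'X^q)); last first.
  by move=> j _; rewrite /= -mulrA -exprD /bump add1n mulSn addnC.
rewrite -mulr_suml => E.
have [r0 s0] : r 0%N = 0 /\ s 0%N = 0.
  have dvd1 : 'X^q %| r 0%N + s 0%N * h ^+ c.
    by move/eqP: E; rewrite addr_eq0 => /eqP->; rewrite -mulNr dvdp_mulIr.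
  have dvd2 : 'X^q %| r 0%N ^+ 2 * h - s 0%N ^+ 2 * h ^+ q.
    have -> : r 0%N ^+ 2 * h - s 0%N ^+ 2 * h ^+ q
       = (r 0%N + s 0%N * h ^+ c) * ((r 0%N - s 0%N * h ^+ c) * h).
      have -> : h ^+ q = h * (h ^+ c * h ^+ c).
        by rewrite -exprD addnn -exprS -qE.
      by ring.
    exact: dvdp_mulr.
  have dvd3 : 'X^q %| r 0%N ^+ 2 * h - h.[0] *: s 0%N ^+ 2.
    have := dvdp_add dvd2 (dvdp_mull (s 0%N ^+ 2) (poly_exp_card_modXn h)).
    by rewrite -mul_polyC; congr (_ %| _); ring.
  apply: (irredp_odd_part_not_square irr_p NpG h00); rewrite -hE.
  apply/eqP; rewrite -subr_eq0; apply/negPn/negP => nz.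
  have := dvdp_leq nz dvd3; rewrite size_polyXn ltnNge => /negP; apply.
  apply: leq_trans (size_polyD _ _) _; rewrite size_polyN geq_max.
  have sz2 (u : {poly F}) : (size u <= B -> size (u ^+ 2) <= (B.*2).-1)%N.
    by move=> szu; apply: leq_trans (size_polyMleq _ _) _; lia.
  have hgt0 : (0 < size h)%N by rewrite size_poly_gt0.
  apply/andP; split.
    apply: leq_trans (size_polyMleq _ _) _.
    move: (sz2 _ (szr 0%N)) hgt0 leBq.
    by move: #|F| (size h) (size (r 0%N ^+ 2)) => x y z; lia.
  apply: leq_trans (size_scale_leq _ _) _.
  move: (sz2 _ (szs 0%N)) hgt0 leBq.
  by move: #|F| (size h) (size (s 0%N ^+ 2)) => x y z; lia.
move/eqP: E; rewrite r0 s0 mul0r !add0r mulf_eq0.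
rewrite (negPf (monic_neq0 (monicXn _ _))) orbF => /eqP E.
case=> [|j] //; rewrite ltnS.
by apply: (IHJ (fun j => r j.+1) (fun j => s j.+1)).
Qed.

(* The coefficient of [Y^l] in [p(X + Y)] is the [l]-th Hasse derivative of [p]; dividing
   by [h ^+ (m - l)] is exact by [exp_dvdp_coef_poly_XaY]. *)
Definition hasse_quotient m l (r : {poly F}) : {poly F} :=
  (poly_XaY (h ^+ m * r))`_l %/ h ^+ (m - l).

Lemma hasse_quotientD m l : {morph hasse_quotient m l : r s / r + s}.
Proof.
by move=> r s; rewrite /hasse_quotient mulrDr poly_XaYD coefD divpD.
Qed.

Lemma hasse_quotientK m l (r : {poly F}) :
  hasse_quotient m l r * h ^+ (m - l) = (poly_XaY (h ^+ m * r))`_l.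
Proof. by rewrite divpK // exp_dvdp_coef_poly_XaY. Qed.

(** The growth depends on [l] and not on [m], since h^(m - l) is divided out. Thus m = M + c, with c
    about q/2, costs no more than m = M. *)
Lemma size_hasse_quotient m l (r : {poly F}) B : (l <= m)%N -> (size r <= B)%N ->
  (size (hasse_quotient m l r) <= B + l * (size h).-1)%N.
Proof.
move=> le_lm szr; rewrite size_divp ?expf_neq0 //.
have hgt0 : (0 < size h)%N by rewrite size_poly_gt0.
have sz_hX k : (size (h ^+ k)).-1 = (k * (size h).-1)%N.
  by rewrite size_exp mulnC.
rewrite sz_hX leq_subLR.
apply: leq_trans (size_coef_poly_XaY _ _) _.
apply: leq_trans (size_polyMleq _ _) _.
have := sz_hX m; have : (0 < size (h ^+ m)%R)%N by rewrite size_poly_gt0 expf_neq0.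
move: (size (h ^+ m)) (size r) ((size h).-1) szr le_lm => u v w.
by nia.
Qed.

(** The factors X^(jq) act as constants: Frobenius turns (X + Y)^(jq) into (X^q + Y^q)^j, which has
    no term of positive order below q in the outer variable. *)
Lemma stepanov_taylor M J l (r s : nat -> {poly F}) :
    (l < M)%N -> (M <= q)%N ->
  (poly_XaY (\sum_(j < J) (h ^+ M * r j + h ^+ (M + c) * s j) * 'X^(j * q)))`_l
  = h ^+ (M - l) * \sum_(j < J)
     (hasse_quotient M l (r j) + hasse_quotient (M + c) l (s j) * h ^+ c)
      * 'X^(j * q).
Proof.
move=> ltlM leMq; rewrite poly_XaY_sum coef_sum mulr_sumr; apply: eq_bigr => j _.
have coefXq (w : {poly {poly F}}) k :
    (w * poly_XaY ('X^(k * q)))`_l = w`_l * 'X^(k * q).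
  rewrite mulnC exprM poly_XaYXn poly_XaYXn poly_XaYX expr_cardD; last first.
    by move=> x; rewrite !pchar_poly.
  elim: k w => [|k IHk] w; first by rewrite !expr0 !mulr1.
  rewrite exprS mulrA IHk exprS mulrA; congr (_ * _).
  rewrite mulrDr coefD coefMXn (leq_trans ltlM leMq) add0r.
  by rewrite -rmorphXn coefMC.
rewrite poly_XaYM coefXq poly_XaYD coefD -2!hasse_quotientK.
by rewrite -addnBAC ?(ltnW ltlM) // exprD; ring.
Qed.

Lemma stepanov_auxiliary (e : F) B M J :
    (M <= q)%N -> (B.*2 + (size h).-1 <= q)%N ->
    (M * (B + M * (size h).-1 + J) < (J * B).*2)%N ->
  exists P : {poly F}, [/\ P != 0,
    (size P <= (M + c) * (size h).-1 + B + J.-1 * q)%N &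
    forall x, h.[x] ^+ c = e -> ('X - x%:P) ^+ M %| P].
Proof.
move=> leMq leBq ltD; set d := (size h).-1; set D := (B + M * d + J)%N.
pose X := {ffun bool * 'I_J * 'I_B -> F}.
pose pol (u : X) (b : bool) (j : nat) : {poly F} :=
  if insub j is Some jj then \sum_(i < B) u (b, jj, i) *: 'X^i else 0.
have polD (u v : X) b j : pol (u + v) b j = pol u b j + pol v b j.
  rewrite /pol; case: insubP => [jj _ _|_]; last by rewrite addr0.
  by rewrite -big_split; apply: eq_bigr => i _; rewrite ffunE scalerDl.
have szpol u b j : (size (pol u b j) <= B)%N.
  rewrite /pol; case: insubP => [jj _ _|_]; last by rewrite size_poly0.
  apply: leq_trans (size_sum _ _ _) _; apply/bigmax_leqP => i _.
  by apply: leq_trans (size_scale_leq _ _) _; rewrite size_polyXn.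
have pol0 (u : X) : (forall b (j : 'I_J), pol u b j = 0) -> u = 0.
  move=> pu0; apply/ffunP => -[[b j] i]; rewrite ffunE.
  have := congr1 (fun t : {poly F} => t`_i) (pu0 b j).
  rewrite /pol valK coef0 coef_sumMXn => <-.
  by rewrite (bigD1 i) ?big1 //= ?addr0 // => k /andP[/eqP/val_inj ->]; rewrite eqxx.
(* At the points to be counted h^c is [e] and x^q = x. Replacing h^c by [e] and X^(jq) by X^j in the
   [l]-th Hasse derivative, without its power of [h], leaves a polynomial of size at most [D], so
   its vanishing is a cheap condition. *)
pose H (u : X) l : {poly F} := \sum_(j < J)
   (hasse_quotient M l (pol u true j)
     + e *: hasse_quotient (M + c) l (pol u false j)) * 'X^j.
have HD (u v : X) l : H (u + v) l = H u l + H v l.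
  rewrite /H -big_split; apply: eq_bigr => j _.
  by rewrite !polD !hasse_quotientD scalerDr /= -mulrDl addrACA.
have szH u l : (l < M)%N -> (size (H u l) <= D)%N.
  move=> ltlM; apply: leq_trans (size_sum _ _ _) _.
  apply/bigmax_leqP => j _; apply: leq_trans (size_polyMleq _ _) _.
  rewrite size_polyXn addnS /=; rewrite /D leq_add ?(ltnW (ltn_ord j)) //.
  apply: leq_trans (size_polyD _ _) _; rewrite geq_max.
  have ld : (B + l * d <= B + M * d)%N by rewrite leq_add2l leq_mul // ltnW.
  apply/andP; split; last apply: leq_trans (size_scale_leq _ _) _.
    by apply: leq_trans (size_hasse_quotient (ltnW ltlM) (szpol _ _ _)) ld.
  apply: leq_trans (size_hasse_quotient _ (szpol _ _ _)) ld.
  by rewrite (leq_trans (ltnW ltlM)) // leq_addr.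
have [u nz_u Hu] : exists2 u : X, u != 0 & forall l, (l < M)%N -> H u l = 0.
  apply: (poly_system_nontrivial_solution HD szH).
  by rewrite !card_prod card_bool !card_ord -mulnA mul2n.
pose P := \sum_(j < J)
  (h ^+ M * pol u true j + h ^+ (M + c) * pol u false j) * 'X^(j * q).
have PE : P = h ^+ M * \sum_(j < J)
    (pol u true j + pol u false j * h ^+ c) * 'X^(j * q).
  by rewrite mulr_sumr; apply: eq_bigr => j _; rewrite exprD; ring.
exists P; split.
- apply: contra_neq nz_u => P0; apply: pol0 => b j.
  move/eqP: P0; rewrite PE mulf_eq0 expf_eq0 (negPf h0) andbF /= => /eqP E.
  have [] := stepanov_independence leBq (szpol u true) (szpol u false) E (ltn_ord j).
  by case: b.
- apply: leq_trans (size_sum _ _ _) _; apply/bigmax_leqP => j _.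
  apply: leq_trans (size_polyMleq _ _) _; rewrite size_polyXn addnS /=.
  apply: leq_add; last by rewrite leq_mul2r -ltnS (ltn_predK (ltn_ord j)) ltn_ord orbT.
  apply: leq_trans (size_polyD _ _) _; rewrite geq_max.
  have szM k b : (k <= M + c)%N -> (size (h ^+ k * pol u b j)%R <= (M + c) * d + B)%N.
    move=> lek; apply: leq_trans (size_polyMleq _ _) _.
    have kE : (size (h ^+ k)).-1 = (k * d)%N by rewrite size_exp mulnC.
    have : (k * d <= (M + c) * d)%N by rewrite leq_mul2r lek orbT.
    move: (szpol u b j); rewrite -kE.
    by move: (size (h ^+ k)) (size (pol u b j)) => x y; lia.
  by rewrite !szM // leq_addr.
- move=> x hx; apply: XsubC_exp_dvdp_Taylor => l ltlM.
  rewrite stepanov_taylor // hornerM; apply/eqP; rewrite mulf_eq0; apply/orP; right.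
  have := congr1 (fun t : {poly F} => t.[x]) (Hu l ltlM); rewrite horner0 => <-.
  rewrite !horner_sum; apply/eqP; apply: eq_bigr => j _.
  rewrite !(hornerM, hornerD, hornerZ, hornerXn, horner_exp).
  by rewrite mulnC exprM expf_card hx [e * _]mulrC.
Qed.

(** The powers of X - x for distinct [x] are coprime, so their product divides the auxiliary
    polynomial. *)
Lemma stepanov_count (e : F) B M J :
    (M <= q)%N -> (B.*2 + (size h).-1 <= q)%N ->
    (M * (B + M * (size h).-1 + J) < (J * B).*2)%N ->
  (#|[set x | h.[x] ^+ c == e]| * M <=
     (M + c) * (size h).-1 + B + J.-1 * q)%N.
Proof.
move=> leMq leBq ltD.
have [P [nzP szP dvdP]] := stepanov_auxiliary e leMq leBq ltD.
apply: leq_trans szP; set S := [set x | _].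
have dvd : \prod_(x in S) ('X - x%:P) ^+ M %| P.
  have {}dvdP x : x \in enum S -> ('X - x%:P) ^+ M %| P.
    by rewrite mem_enum inE => /eqP; apply: dvdP.
  rewrite -big_enum /=; elim: (enum S) (enum_uniq S) dvdP => [|x t IHt] /=.
    by rewrite big_nil dvd1p.
  case/andP=> Nxt uniq_t dvdP; rewrite big_cons Gauss_dvdp.
    rewrite dvdP ?mem_head // IHt // => y ty; apply: dvdP.
    by rewrite inE ty orbT.
  apply: coprimep_expl; rewrite coprimep_sym coprimep_XsubC /root.
  rewrite horner_prod prodf_seq_neq0.
  apply/allP => y ty /=; rewrite horner_exp !hornerE expf_eq0 negb_and subr_eq0.
  by apply/orP; right; apply: contraNneq Nxt => ->.
apply: leq_trans (dvdp_leq nzP dvd); apply: leq_trans (leq_pred _).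
by rewrite prodrXl size_exp -big_enum size_prod_XsubC -cardE.
Qed.

Lemma stepanov_bound (e : F) m :
    (0 < m)%N -> (m.*2 ^ 2 <= q)%N -> ((size h + m.*2).*2 <= q)%N ->
    (q <= 16 * m.*2 ^ 2)%N ->
  (#|[set x | h.[x] ^+ c == e]|.*2 <= q + 98 * size h * m.*2)%N.
Proof.
move=> m_gt0 leMq ledq leq16.
have hgt0 : (0 < size h)%N by rewrite size_poly_gt0.
(* [B] is the largest value with 2B + deg h <= q. The main part of [J] is M/2 for M = 2m, so that
   Jq/M has leading term q/2. *)
pose B := (q - (size h).-1)./2; pose J := (m + (size h).*2)%N.
have leMq' : (m.*2 <= q)%N by apply: leq_trans leMq; rewrite leq_pmulr // double_gt0.
have leBq : (B.*2 + (size h).-1 <= q)%N.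
  by move: ledq hgt0; rewrite /B; move: #|F| (size h) => x y; lia.
have leqB : (q <= B.*2 + size h)%N.
  by move: ledq hgt0; rewrite /B; move: #|F| (size h) => x y; lia.
have := @stepanov_count e B m.*2 J leMq' leBq; rewrite {}/J.
move: hgt0 leMq ledq leq16 leBq leqB; case: (size h) => //= d _.
move=> leMq ledq leq16 leBq leqB step.
apply: (stepanov_degree_estimate leq16 leBq m_gt0); apply: step.
exact: (stepanov_unknowns_gt_equations m_gt0 leMq ledq leqB).
Qed.

End Stepanov.

(** * Nonsquares in the critical orbit *)

Section OddField.

Variable F : finFieldType.
Local Notation c := (#|F|./2).
Hypothesis odd_q : odd #|F|.

Lemma two_neq0_odd_card : 2%:R != 0 :> F.
Proof.
apply/negP => two0; have char2 : 2%N \in [pchar F] by rewrite inE.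
have := card_pprimeChar char2; rewrite (_ : #|_| = #|F|) //.
move: odd_q (finNzRing_gt1 F); move: (logn 2 _) => k + + E; rewrite E oddX orbF.
by move/eqP->.
Qed.

Lemma one_neqN1_odd_card : 1 != -1 :> F.
Proof. by rewrite -subr_eq0 opprK two_neq0_odd_card. Qed.

Lemma expf_pred_card (x : F) : x != 0 -> x ^+ c.*2 = 1.
Proof.
move=> x0; apply: (mulfI x0); rewrite mulr1 -exprS.
have -> : c.*2.+1 = #|F| by rewrite -[RHS]odd_double_half odd_q.
exact: expf_card.
Qed.

Lemma half_power_pm1 (x : F) : x != 0 -> (x ^+ c == 1) || (x ^+ c == -1).
Proof. by move=> x0; rewrite -sqrf_eq1 -exprM muln2 expf_pred_card. Qed.

End OddField.

(** With x = g^k for a generator [g] of the unit group, the order 2c of [g] divides kc, so [k] is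
    even. *)
Lemma euler_criterion (F : finFieldType) (x : F) :
  odd #|F| -> x ^+ (#|F|./2) = 1 -> exists y, x = y ^+ 2.
Proof.
move=> odd_q xc1.
have qE : #|F| = (#|F|./2).*2.+1 by rewrite -[LHS]odd_double_half odd_q.
have c_gt0 : (0 < #|F|./2)%N.
  by have := finNzRing_gt1 F; rewrite qE; case: (#|F|./2).
have nz_x : x != 0.
  by apply: contra_eq_neq xc1 => ->; rewrite expr0n gtn_eqF // eq_sym oner_neq0.
have /cyclicP[g gE] := field_unit_group_cyclic [set: {unit F}]%G.
have /cycleP[k uE] : finField_unit nz_x \in <[g]>%g by rewrite -gE inE.
have xE : x = val g ^+ k by rewrite -FinRing.val_unitX -uE.
have : (g ^+ (k * #|F|./2) == 1)%g.
  by rewrite -val_eqE FinRing.val_unitX exprM -xE xc1.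
rewrite -order_dvdn orderE -gE card_finField_unit {1}qE /= -mul2n.
rewrite dvdn_pmul2r // => /dvdnP[i kE].
by exists (val g ^+ i); rewrite -exprM -kE.
Qed.
(** X^q - X already splits over [F]. *)
Lemma frobenius_fixed_mem1 (F : finFieldType) (L : fieldExtType F) (x : L) :
  x ^+ #|F| = x -> x \in 1%VS.
Proof.
move=> xq; have := congr1 (map_poly (in_alg L)) (finField_genPoly F).
rewrite rmorphB /= map_polyXn map_polyX rmorph_prod /=.
move/(congr1 (horner^~ x)); rewrite !hornerE xq subrr horner_prod.
move/esym/eqP; rewrite prodf_seq_eq0 => /hasP[a _ /=].
rewrite rmorphB /= map_polyX map_polyC !hornerE subr_eq0 => /eqP->.
by rewrite rpredZ ?mem1v.
Qed.

(** Through this identity a half power in an extension of degree [m] is the half power over [F] of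
    the norm, the power 1 + q + ... + q^(m-1). *)
Lemma half_expn_sum q m : odd q -> (q ^ m)./2 = (q./2 * \sum_(i < m) q ^ i)%N.
Proof.
move=> odd_q; apply: double_inj; rewrite doubleMl.
have -> : q./2.*2 = q.-1 by rewrite -[in RHS](odd_double_half q) odd_q.
by rewrite -predn_exp -[in RHS](odd_double_half (q ^ m)) oddX odd_q orbT.
Qed.

(** * Norms from finite extensions *)

Section FiniteExtension.

Variables (F : finFieldType) (L : fieldExtType F).
Local Notation iota := (map_poly (in_alg L)).

Lemma in_algX (a : F) n : (a ^+ n)%:A = a%:A ^+ n :> L.
Proof. by rewrite exprZn expr1n. Qed.

Lemma card_finvect_ext : #|finvect_type L| = (#|F| ^ \dim {:L})%N.
Proof. by rewrite -(card_vspacef (Vector.class (finvect_type L))) card_vspace. Qed.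

Lemma expf_card_ext (x : L) : x ^+ (#|F| ^ \dim {:L}) = x.
Proof.
by have := @expf_card (finvect_type L) x; rewrite card_finvect_ext.
Qed.

Lemma irredp_dvd_of_root (g r : {poly F}) (z : L) :
  irreducible_poly g -> root (iota g) z -> root (iota r) z -> g %| r.
Proof.
move=> irr_g gz rz; apply/negPn/negP.
rewrite -irreducible_poly_coprime // -(coprimep_map (in_alg L)).
by move/coprimep_root/(_ gz); rewrite -rootE rz.
Qed.

Lemma irredp_root_dim (g : {poly F}) (z : L) :
  irreducible_poly g -> root (iota g) z -> (size g <= (\dim {:L}).+1)%N.
Proof.
move=> irr_g gz.
have /polyOver1P[r rE] := minPolyOver 1%AS z.
have := root_minPoly 1%AS z; rewrite rE => rz.
have nz_r : r != 0.
  by rewrite -(map_poly_eq0 (in_alg L)) -rE monic_neq0 // monic_minPoly.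
apply: leq_trans (dvdp_leq nz_r (irredp_dvd_of_root irr_g gz rz)) _.
rewrite -(size_map_poly (in_alg L)) -rE size_minPoly ltnS.
by rewrite adjoin_degreeE dimv1 divn1 dimvS // subvf.
Qed.

Lemma exists_frobenius_power :
  exists phi : {rmorphism L -> L}, forall x, phi x = x ^+ #|F|.
Proof.
have [p pr_p charFp] := finPcharP F.
have charLp : p \in [pchar L] by rewrite pchar_lalg.
have -> := card_pprimeChar charFp; rewrite (_ : #|_| = #|F|) //.
elim: (logn p #|F|) => [|k [phi phiE]]; first by exists idfun.
exists (pFrobenius_aut charLp \o phi) => x /=.
by rewrite phiE pFrobenius_autE -exprM expnSr.
Qed.

(** Frobenius permutes the factors X - z^(q^i) cyclically, so their product has coefficients in [F].
    It vanishes at [z] and has the degree of [g], hence it is [g] made monic. *)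
Lemma norm_root (g : {poly F}) (z : L) (y : F) :
    irreducible_poly g -> (size g).-1 = \dim {:L} -> root (iota g) z ->
  \prod_(i < \dim {:L}) (y%:A - z ^+ (#|F| ^ i)) = (g.[y] / lead_coef g)%:A.
Proof.
move=> irr_g szg gz; set m := \dim {:L}.
have [phi phiE] := exists_frobenius_power.
pose G := \prod_(i < m) ('X - (z ^+ (#|F| ^ i))%:P).
have phiG : map_poly phi G = G.
  rewrite rmorph_prod /= (eq_bigr (fun i : 'I_m => 'X - (z ^+ (#|F| ^ i.+1))%:P)).
    rewrite /G; move: (expf_card_ext z); rewrite -/m.
    clear G; case: m {szg} => [|k] zE; first by rewrite !big_ord0.
    by rewrite big_ord_recr big_ord_recl /= zE expn0 expr1 mulrC.
  by move=> i _; rewrite rmorphB /= map_polyX map_polyC /= phiE -exprM expnSr.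
have /polyOver1P[g' g'E] : G \is a polyOver 1%VS.
  apply/polyOverP => i; apply: frobenius_fixed_mem1.
  by rewrite -phiE -[in RHS]phiG coef_map.
have g'z : root (iota g') z.
  rewrite -g'E /G -/m; have : (0 < m)%N by rewrite /m adim_gt0.
  case: (m) => // k _; rewrite big_ord_recl rootM expn0 expr1.
  by rewrite rootE !hornerE subrr eqxx.
have szG : size g' = m.+1.
  rewrite -(size_map_poly (in_alg L)) -g'E /G size_prod_XsubC.
  by rewrite -[index_enum _]enumT size_enum_ord.
have lc_g' : lead_coef g' = 1.
  apply: (fmorph_inj (in_alg L)); rewrite -lead_coef_map -g'E rmorph1.
  by apply/eqP/monic_prod_XsubC.
have gg' : g %= g'.
  rewrite -dvdp_size_eqp ?(irredp_dvd_of_root irr_g gz) // szG /m -szg.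
  by rewrite prednK // ltnW //; case: irr_g.
have lc0 : lead_coef g != 0 by rewrite lead_coef_eq0 -size_poly_gt0 ltnW //; case: irr_g.
have gE : g.[y] / lead_coef g = g'.[y].
  have /eqpf_eq[a a0 gE] := gg'.
  by rewrite gE lead_coefZ lc_g' mulr1 hornerZ mulrC mulKf.
rewrite gE -[RHS]/(in_alg L _) -horner_map -g'E horner_prod; apply: eq_bigr => i _.
by rewrite !hornerE.
Qed.

(** The quadratic character of y - z in [L] is that of its norm in [F]. *)
Lemma subr_root_half_power (g : {poly F}) (z : L) (y : F) :
    odd #|F| -> irreducible_poly g -> (size g).-1 = \dim {:L} ->
    root (iota g) z ->
  (y%:A - z) ^+ (#|finvect_type L|./2)
    = ((g.[y] / lead_coef g) ^+ (#|F|./2))%:A.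
Proof.
move=> odd_q irr_g szg gz; rewrite card_finvect_ext half_expn_sum // mulnC exprM.
rewrite in_algX -(norm_root y irr_g szg gz); congr (_ ^+ _).
rewrite expr_sum; apply: eq_bigr => i _.
have [phi phiE] := exists_frobenius_power.
elim: (i : nat) => [|k IHk]; first by rewrite expn0 !expr1.
rewrite expnSr exprM IHk -phiE rmorphB /= !phiE -exprM.
by congr (_ - _); rewrite -in_algX expf_card.
Qed.

(** Scalars become squares in an extension of even degree m: 1 + q + ... + q^(m-1) is a sum of m odd
    numbers, thus even. *)
Lemma scalar_half_power (a : F) : odd #|F| -> ~~ odd (\dim {:L}) -> a != 0 ->
  a ^+ (#|finvect_type L|./2) = 1.
Proof.
move=> odd_q even_m a0; rewrite card_finvect_ext half_expn_sum //.
have /dvdnP[k ->] : (2 %| \sum_(i < \dim {:L}) #|F| ^ i)%N.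
  rewrite dvdn2; apply: contra even_m.
  rewrite (big_morph odd oddD (erefl _)).
  rewrite (eq_bigr (fun=> true)); last by move=> i _; rewrite oddX odd_q orbT.
  by rewrite big_const_ord; elim: (\dim _).
rewrite mulnCA mulnC muln2.
by rewrite exprM expf_pred_card ?expr1n.
Qed.

End FiniteExtension.

Lemma irredp_no_root (F : fieldType) (p : {poly F}) x :
  irreducible_poly p -> (2 < size p)%N -> p.[x] != 0.
Proof.
move=> [_ irr_p] sz_p; apply/negP => px0.
have /irr_p : 'X - x%:P %| p by rewrite dvdp_XsubCl.
by rewrite size_XsubC => /(_ isT)/eqp_size; rewrite size_XsubC => E; rewrite -E in sz_p.
Qed.

(** * Iterates of a stable quadratic polynomial *)

Section QuadraticIterates.

Variables (F : finFieldType) (f : {poly F}).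
Hypotheses (odd_q : odd #|F|) (sz_f : size f = 3%N).
Local Notation a := (f`_2).
Local Notation gamma := (critical_point f).
Local Notation it := (poly_iterate f).

Lemma quadratic_lead_neq0 : a != 0.
Proof.
by rewrite -[2%N]/(3%N.-1) -sz_f -lead_coefE lead_coef_eq0 -size_poly_eq0 sz_f.
Qed.

Lemma poly_iterateSr n : it n.+1 = it n \Po f.
Proof.
elim: n => [|n IHn]; first by rewrite /poly_iterate /= comp_polyXr comp_polyX.
by transitivity (f \Po (it n \Po f)); [rewrite -IHn | exact: comp_polyA].
Qed.

Lemma horner_poly_iterateD m n x : (it (m + n)).[x] = (it m).[(it n).[x]].
Proof.
elim: m => [|m IHm]; first by rewrite /= hornerX.
by rewrite addSn /poly_iterate !iterS -!/(poly_iterate _ _) !horner_comp IHm.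
Qed.

Lemma size_poly_iterate n : size (it n) = (2 ^ n).+1.
Proof.
elim: n => [|n IHn]; first by rewrite size_polyX.
have : (size (it n.+1)).-1 = (2 ^ n.+1)%N by rewrite size_comp_poly IHn sz_f expnS.
by case: (size _) => [/esym/eqP|k /= -> //]; rewrite expn_eq0.
Qed.

Lemma lead_coef_poly_iterateS n :
  lead_coef (it n.+1) = a * lead_coef (it n) ^+ 2.
Proof.
rewrite lead_coef_comp ?size_poly_iterate ?ltnS ?expn_gt0 //.
by rewrite lead_coefE sz_f.
Qed.

Lemma quadratic_vertex_form (L : fieldExtType F) (x : L) :
  (map_poly (in_alg L) f).[x + gamma%:A] = a *: x ^+ 2 + (f.[gamma])%:A.
Proof.
have bE : f`_1 = - (2%:R * a * gamma).
  rewrite /critical_point mulrC divfK ?opprK // mulf_neq0 ?quadratic_lead_neq0 //.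
  exact: two_neq0_odd_card.
rewrite horner_coef size_map_poly sz_f (horner_coef f) sz_f.
rewrite !big_ord_recr !big_ord0 !coef_map /= !add0r.
rewrite bE -[X in _ = X + _]mulr_algl !(scalerDl, scaleNr, expr0, expr1, mulr1).
move: (f`_0) (f`_2) gamma => u v w.
have M (s t : F) : (s * t)%:A = s%:A * t%:A :> L by rewrite mulr_algl scalerA.
rewrite !M !scaleNr !M (_ : 2%:R%:A = 2%:R :> L); last by rewrite scaler_nat.
by ring.
Qed.

Hypothesis stab_f : stable_poly f.

Lemma stable_iterate_neq0 n x : (0 < n)%N -> (it n).[x] != 0.
Proof.
move=> n_gt0; apply: irredp_no_root; first exact: stab_f.
by rewrite size_poly_iterate ltnS -[1%N]/(2 ^ 0)%N ltn_exp2l.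
Qed.

(** Let [z] be a root of g = f^(n-1) in [L] of degree 2^(n-1). The norm of f(gamma) - z is
    f^(n)(gamma) over the leading coefficient of [g]. If a f^(n)(gamma) were a square, then (z -
    f(gamma))/a = x^2 in [L], and x + gamma would be a root in [L] of f^(n), irreducible of degree
    2^n. *)
Lemma stable_critical_nonsquare n :
  (1 < n)%N -> (a * (it n).[gamma]) ^+ (#|F|./2) = -1.
Proof.
case: n => [|[|n]] // _; set g := it n.+1; set v := (it n.+2).[gamma].
have vE : v = g.[f.[gamma]] by rewrite /v poly_iterateSr horner_comp.
have v0 : v != 0 by rewrite stable_iterate_neq0.
have a0 := quadratic_lead_neq0.
have irr_g : irreducible_poly g by apply: stab_f.
case/orP: (half_power_pm1 odd_q (mulf_neq0 a0 v0)) => /eqP // av1; exfalso.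
have [L dimL [z gz _]] := irredp_FAdjoin irr_g.
have szg : (size g).-1 = \dim {:L} by rewrite dimL.
(* The original index is at least 2, so [g] has even degree and -1/a is a square in [L]. *)
have even_m : ~~ odd (\dim {:L}).
  by rewrite -szg size_poly_iterate /= expnS oddM.
have [x xE] : exists x : L, (z - (f.[gamma])%:A) * (a^-1)%:A = x ^+ 2.
  apply: (@euler_criterion (finvect_type L)).
    by rewrite card_finvect_ext oddX odd_q orbT.
  rewrite -[LHS]/(((z - (f.[gamma])%:A) * (a^-1)%:A : L) ^+ _).
  have -> : (z - (f.[gamma])%:A) * (a^-1)%:A = ((f.[gamma])%:A - z) * (- a^-1)%:A.
    by rewrite scaleNr mulrN -mulNr opprB.
  rewrite exprMn (subr_root_half_power _ odd_q irr_g szg gz) -vE.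
  rewrite -in_algX scalar_half_power ?oppr_eq0 ?invr_eq0 // scale1r mulr1.
  (* The leading coefficient of [g] is a t^2: dividing by it is multiplying by [a] up to a
     square. *)
  rewrite lead_coef_poly_iterateS; set t := lead_coef _.
  have t0 : t != 0 by rewrite lead_coef_eq0 -size_poly_eq0 size_poly_iterate.
  have -> : v / (a * t ^+ 2) = (a * v) * ((a * t)^-1) ^+ 2 by field; rewrite a0 t0.
  rewrite exprMn av1 mul1r -exprM mul2n expf_pred_card //.
    by rewrite scale1r.
  by rewrite invr_eq0 mulf_neq0.
have root_it : root (map_poly (in_alg L) (it n.+2)) (x + gamma%:A).
  rewrite poly_iterateSr map_comp_poly rootE horner_comp quadratic_vertex_form.
  by rewrite -xE mulr_algr scalerA mulfV // scale1r subrK.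
have := irredp_root_dim (stab_f (ltn0Sn n.+1)) root_it.
by rewrite -szg !size_poly_iterate ltnS leq_exp2l // ltnn.
Qed.

End QuadraticIterates.

(** * Character sums over the critical orbit *)

Section QuadraticCharacter.

Variable F : finFieldType.
Hypothesis odd_q : odd #|F|.
Local Notation c := (#|F|./2).

(** Defined by Euler's criterion; 0 is sent to -1, and the arguments used below are nonzero. *)
Definition quad_char (x : F) : int := if x ^+ c == 1 then 1 else -1.

Lemma quad_charM (x y : F) : x != 0 -> y != 0 ->
  quad_char (x * y) = quad_char x * quad_char y.
Proof.
move=> x0 y0; rewrite /quad_char exprMn.
have N1 := negPf (one_neqN1_odd_card odd_q).
case/orP: (half_power_pm1 odd_q x0) => /eqP->;
case/orP: (half_power_pm1 odd_q y0) => /eqP->;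
by rewrite ?(mulr1, mul1r, mulrNN, eqxx, eq_sym (-1) (1 : F), N1).
Qed.

Lemma quad_char_prod (I : finType) (P : pred I) (v : I -> F) :
    (forall i, v i != 0) ->
  quad_char (\prod_(i | P i) v i) = \prod_(i | P i) quad_char (v i).
Proof.
move=> v0.
suff [_ //] : \prod_(i | P i) v i != 0 /\
  quad_char (\prod_(i | P i) v i) = \prod_(i | P i) quad_char (v i).
elim/big_rec2: _ => [|i y1 y2 _ [y0 <-]].
  by rewrite oner_neq0 /quad_char expr1n eqxx.
by rewrite mulf_neq0 ?v0 // quad_charM ?v0.
Qed.

(** Stepanov's bound is one-sided, but it applies to both h^c = 1 and h^c = -1. These two sets
    partition [F], so the two upper bounds control the difference of their sizes. *)
Lemma quad_char_sum_bound (h p G : {poly F}) m :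
    irreducible_poly p -> ~~ (p %| G) -> h = p * G ->
    (forall x, h.[x] != 0) -> (0 < m)%N -> (m.*2 ^ 2 <= #|F|)%N ->
    ((size h + m.*2).*2 <= #|F|)%N -> (#|F| <= 16 * m.*2 ^ 2)%N ->
  `|\sum_x quad_char h.[x]| <= (98 * size h * m.*2)%:R.
Proof.
move=> irr_p NpG hE h_neq0 m_gt0 leMq ledq leq16.
have bound e := stepanov_bound odd_q irr_p NpG hE (h_neq0 0) e m_gt0 leMq ledq leq16.
have := bound 1; have := bound (-1).
set S1 := [set x | h.[x] ^+ c == 1]; set SN := [set x | h.[x] ^+ c == -1].
have SNE : SN = ~: S1.
  apply/setP => x; rewrite !inE; case/orP: (half_power_pm1 odd_q (h_neq0 x)) => /eqP->.
    by rewrite eqxx (negPf (one_neqN1_odd_card odd_q)).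
  by rewrite eqxx eq_sym one_neqN1_odd_card.
have card_eq : (#|S1| + #|SN| = #|F|)%N by rewrite SNE cardsC.
have -> : \sum_x quad_char h.[x] = #|S1|%:R - #|SN|%:R.
  rewrite (bigID (mem S1)) /=; congr (_ + _).
    rewrite (eq_bigr (fun=> 1)) ?sumr_const // => x.
    by rewrite inE /quad_char => ->.
  rewrite (eq_bigl (fun x => x \in SN)); last by move=> x /=; rewrite SNE [RHS]inE.
  rewrite (eq_bigr (fun=> -1)); first by rewrite sumr_const mulNrn.
  by move=> x; rewrite SNE !inE /quad_char => /negPf->.
move: (98 * size h * m.*2)%N #|S1| #|SN| #|F| card_eq => E u v w; lia.
Qed.

End QuadraticCharacter.

(** * Counting the critical orbit *)

Section CriticalOrbit.

Variables (F : finFieldType) (f : {poly F}).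
Hypotheses (odd_q : odd #|F|) (sz_f : size f = 3%N) (stab_f : stable_poly f).
Local Notation a := (f`_2).
Local Notation gamma := (critical_point f).
Local Notation it := (poly_iterate f).

Lemma t_crit_inj i j : (0 < i < j)%N -> (j < t_crit f)%N ->
  (it i).[gamma] != (it j).[gamma].
Proof.
move=> /andP[i_gt0 ltij]; rewrite /t_crit; case: ex_minnP => t _ t_min ltjt.
apply/negP => eq_ij.
have /t_min : (0 < j)%N && critical_collision f j.
  rewrite (leq_ltn_trans _ ltij) //=; apply/existsP; exists (Ordinal ltij).
  by rewrite /= i_gt0 eq_sym.
by rewrite leqNgt ltjt.
Qed.

(** The indices run over 1, ..., t - 1. Applying f^(k) with k >= 1 reaches an index of at least 2,
    where the values times [a] are nonsquares. *)
Definition critical_orbit : {set F} :=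
  [set (it i.+1).[gamma] | i : 'I_(t_crit f).-1].

Lemma card_critical_orbit : #|critical_orbit| = (t_crit f).-1.
Proof.
rewrite card_imset ?card_ord // => i j /eqP eq_ij; apply: val_inj.
have lt_t (k : 'I_(t_crit f).-1) : (k.+1 < t_crit f)%N.
  by case: k => k; case: (t_crit f).
case: (ltngtP i j) => // [ltij|ltji].
  by have := @t_crit_inj i.+1 j.+1 ltij (lt_t j); rewrite eq_ij.
by have := @t_crit_inj j.+1 i.+1 ltji (lt_t i); rewrite eq_sym eq_ij.
Qed.

Lemma t_crit_le_card : (t_crit f <= #|F|.+1)%N.
Proof.
by have := max_card (mem critical_orbit); rewrite card_critical_orbit; case: (t_crit f).
Qed.

Variable K : nat.
Let s := (2 ^ K)%N.
Let lin (i : 'I_K) (x : F) : F := a * (it i.+1).[x].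

Let lin_neq0 i x : lin i x != 0.
Proof. by rewrite mulf_neq0 ?quadratic_lead_neq0 // stable_iterate_neq0. Qed.

Let prodpoly (S : {set 'I_K}) : {poly F} := \prod_(i in S) (a *: it i.+1).

Let size_prodpoly (S : {set 'I_K}) : (size (prodpoly S) <= s.*2)%N.
Proof.
apply: (@leq_trans (\sum_(i in S) 2 ^ i.+1)%N.+1).
  rewrite /prodpoly; elim/big_rec2: _ => [|i y1 y2 _ le_y]; first by rewrite size_poly1.
  apply: leq_trans (size_polyMleq _ _) _.
  rewrite size_scale ?quadratic_lead_neq0 // size_poly_iterate //.
  by rewrite addSn /= -addnS leq_add2l.
apply: (@leq_ltn_trans (\sum_(i < K) 2 ^ i.+1)%N).
  by rewrite [leqRHS](bigID (mem S)) /= leq_addr.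
rewrite (eq_bigr (fun i : 'I_K => 2 * 2 ^ i)%N) => [|i _]; last by rewrite expnS.
rewrite -big_distrr /= -[(\sum_(i < K) _)%N]mul1n -[1%N]/(2.-1) -predn_exp.
by rewrite mul2n ltn_double prednK // expn_gt0.
Qed.

Let horner_prodpoly S x : (prodpoly S).[x] = \prod_(i in S) lin i x.
Proof. by rewrite horner_prod; apply: eq_bigr => i _; rewrite hornerZ. Qed.

Let orbit_char x : x \in critical_orbit -> forall i, quad_char (lin i x) = -1.
Proof.
case/imsetP => j _ -> i; rewrite /quad_char /lin -horner_poly_iterateD.
rewrite stable_critical_nonsquare //; last by rewrite addnS.
by rewrite eq_sym (negPf (one_neqN1_odd_card odd_q)).
Qed.

Hypotheses (K_gt0 : (0 < K)%N) (leq_s4 : (s ^ 4 <= #|F|)%N).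
Hypothesis (leq_16s4 : (#|F| <= 16 * s ^ 4)%N).

Let s_ge2 : (2 <= s)%N.
Proof. by rewrite -[2%N]expn1 leq_exp2l. Qed.

Let subset_sum_bound (S : {set 'I_K}) : S != set0 ->
  `|\sum_x \prod_(i in S) quad_char (lin i x)| <= (196 * s ^ 3)%:R.
Proof.
case/set0Pn => i Si.
have irr_i : irreducible_poly (it i.+1) by apply: stab_f.
(* The iterates are irreducible of distinct degrees, so [it i.+1] divides the product exactly
   once. *)
have Ndvd : ~~ (it i.+1 %| a *: \prod_(j in S :\ i) (a *: it j.+1)).
  rewrite dvdpZr ?quadratic_lead_neq0 //; apply/negP.
  case/(irredp_dvd_prod irr_i) => j; rewrite !inE => /andP[neq_ji _].
  rewrite dvdpZr ?quadratic_lead_neq0 // => dvd_ij.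
  have /eqp_size : it i.+1 %= it j.+1.
    apply: (apply_irredp _ _ dvd_ij); first exact: stab_f.
    by rewrite size_poly_iterate // eqSS expn_eq0.
  rewrite !size_poly_iterate // => -[] /eqP.
  rewrite eqn_exp2l // eqSS => /eqP/val_inj eq_ij.
  by rewrite eq_ij eqxx in neq_ji.
have hE : prodpoly S = it i.+1 * (a *: \prod_(j in S :\ i) (a *: it j.+1)).
  rewrite /prodpoly (bigD1 i) //= -scalerAl scalerAr; congr (_ * (_ *: _)).
  by apply: eq_bigl => j; rewrite !inE andbC.
have h_neq0 x : (prodpoly S).[x] != 0.
  by rewrite horner_prodpoly; apply/prodf_neq0.
(* With M = 2m = s^2 the hypotheses on q read M^2 <= q <= 16 M^2. *)
pose m := (2 ^ (K.*2.-1))%N.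
have mE : m.*2 = (s ^ 2)%N.
  by rewrite -mul2n -expnS prednK ?double_gt0 // -muln2 expnM.
have m_gt0 : (0 < m)%N by rewrite expn_gt0.
have s2 : ((s ^ 2) ^ 2 = s ^ 4)%N by rewrite -expnM.
have := quad_char_sum_bound odd_q irr_i Ndvd hE h_neq0 m_gt0; rewrite mE s2.
move=> /(_ leq_s4 _ leq_16s4) bound.
have {bound} : `|\sum_x quad_char (prodpoly S).[x]|
    <= (98 * size (prodpoly S) * s ^ 2)%:R.
  (* This needs 2(2s + s^2) <= s^4, true from s = 2 on, with equality there. *)
  apply: bound; apply: leq_trans leq_s4.
  move: (size_prodpoly S) s_ge2; move: (size _) s => u v.
  by rewrite -!mulnn !expnS; nia.
rewrite (eq_bigr (fun x => \prod_(i in S) quad_char (lin i x))); last first.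
  by move=> x _; rewrite horner_prodpoly quad_char_prod.
move/le_trans; apply; rewrite ler_nat.
have -> : (196 * s ^ 3 = 98 * s.*2 * s ^ 2)%N by rewrite !expnS; lia.
by rewrite leq_mul2r leq_mul2l size_prodpoly !orbT.
Qed.

(** Each factor of [T] is 0 or 2, and all are 2 at orbit points, which contribute s = 2^K each.
    Expanded over subsets of indices, the empty set gives q and every other one at most 196 s^3. *)
Lemma t_crit_bound : (t_crit f <= 213 * s ^ 3)%N.
Proof.
pose T : int := \sum_x \prod_(i < K) (- quad_char (lin i x) + 1).
have term_ge0 x : 0 <= \prod_(i < K) (- quad_char (lin i x) + 1).
  by apply: prodr_ge0 => i _; rewrite /quad_char; case: ifP.
have lower : (s * (t_crit f).-1)%:R <= T.
  rewrite -card_critical_orbit mulrnA -sumr_const.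
  rewrite /T [leRHS](bigID (mem critical_orbit)) /= -[leLHS]addr0.
  apply: lerD; last by apply: sumr_ge0.
  apply: ler_sum => x Ox; rewrite (eq_bigr (fun=> 2%:R)).
    by rewrite prodr_const card_ord natrX.
  by move=> i _; rewrite orbit_char.
have upper : T <= (#|F| + s * (196 * s ^ 3))%:R.
  have -> : T = \sum_(S : {set 'I_K}) \sum_x
      \prod_i (if i \in S then - quad_char (lin i x) else 1).
    rewrite exchange_big; apply: eq_bigr => x _ /=.
    exact: (bigA_distr 1 +%R).
  rewrite (bigD1 set0) //= natrD; apply: lerD.
    rewrite (eq_bigr (fun=> 1)) ?sumr_const // => x _.
    by apply: big1 => i _; rewrite inE.
  apply: le_trans (_ : \sum_(S : {set 'I_K} | S != set0) (196 * s ^ 3)%:R <= _).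
    apply: ler_sum => S nzS; apply: le_trans (subset_sum_bound nzS).
    rewrite (eq_bigr (fun x => (-1) ^+ #|S| * \prod_(i in S) quad_char (lin i x))).
      rewrite -mulr_sumr; apply: le_trans (ler_norm _) _.
      by rewrite normrM normrX normrN1 expr1n mul1r.
    move=> x _; rewrite -big_mkcond /= -prodr_const -big_split /=.
    by apply: eq_bigr => i _; rewrite mulN1r.
  rewrite sumr_const -mulrnA ler_nat mulnC leq_mul2r.
  apply/orP; right; apply: leq_trans (max_card _) _.
  by rewrite -cardsT -powersetT card_powerset cardsT card_ord.
have := le_trans lower upper; rewrite ler_nat => bound.
have s_gt0 : (0 < s)%N by rewrite expn_gt0.
(* Here q <= 16 s^4 and 212 = 16 + 196; passing from t - 1 to t then costs the last unit of 213. *)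
have {}bound : (s * (t_crit f).-1 <= s * (212 * s ^ 3))%N.
  apply: leq_trans bound _; move: leq_16s4; rewrite !expnS; by move: #|F| => u; lia.
move: bound; rewrite leq_pmul2l // => bound.
have : (0 < s ^ 3)%N by rewrite expn_gt0 s_gt0.
move: bound; move: (t_crit f) (s ^ 3)%N => u v; lia.
Qed.

End CriticalOrbit.

(** Taking s = 2^K with 16^K <= q < 16^(K+1) gives s^4 <= q < 16 s^4. *)
Lemma t_crit_dyadic_bound (F : finFieldType) (f : {poly F}) :
    odd #|F| -> size f = 3%N -> stable_poly f ->
  exists2 s : nat, (s ^ 4 <= #|F|)%N & (t_crit f <= 213 * s ^ 3)%N.
Proof.
move=> odd_q sz_f stab_f; have q_gt1 := finNzRing_gt1 F.
pose K := trunc_log 16 #|F|.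
have sE : ((2 ^ K) ^ 4 = 16 ^ K)%N by rewrite -expnM mulnC expnM.
have /andP[leKq ltqK] := trunc_log_bounds (isT : 1 < 16)%N (ltnW q_gt1).
exists (2 ^ K)%N; first by rewrite sE.
(* If K = 0 then q < 16, and t <= q + 1 <= 16 is enough. *)
have [K0|K_gt0] := posnP K.
  move: ltqK; rewrite -/K K0 expn1 => ltq16.
  by apply: leq_trans (t_crit_le_card f) _; apply: leq_trans ltq16 _.
apply: t_crit_bound => //; rewrite sE //.
by rewrite -expnS ltnW.
Qed.

Theorem theorem1 (R : realType) :
  exists C : R, 0 < C /\
    forall (F : finFieldType) (f : {poly F}),
      odd #|F| -> size f = 3%N -> stable_poly f ->
      (t_crit f)%:R <= C * powR (#|F|%:R) (3%:R / 4%:R).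
Proof.
exists 213%:R; split=> [|F f odd_q sz_f stab_f]; first by rewrite ltr0n.
have [s les4 let_s3] := t_crit_dyadic_bound odd_q sz_f stab_f.
apply: (@le_trans _ _ (213 * s ^ 3)%:R); first by rewrite ler_nat.
rewrite natrM ler_pM2l ?ltr0n //.
have -> : (s ^ 3)%:R = powR ((s ^ 4)%:R : R) (3%:R / 4%:R).
  rewrite !natrX -[s%:R ^+ 4]powR_mulrn ?ler0n // -powRrM mulrC divfK ?pnatr_eq0 //.
  by rewrite powR_mulrn ?ler0n.
by apply: ge0_ler_powR; rewrite ?nnegrE ?ler0n ?ler_nat ?divr_ge0 ?ler0n.
Qed.
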